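(* Let $a_{0},b_{0}\in\mathbb R$ with $a_{0}<b_{0}$, and let $\ell$ and $r$ be non-negative integers. Let $f$ be a real-valued $C^{\ell}$-function on a neighborhood of $x=a_{0}$, and let $g$ be a real-valued $C^{r}$-function on a neighborhood of $x=b_{0}$. Let $H$ be the polynomial of degree at most $\ell+r+1$ that satisfies $$H^{(j)}(a_{0})=f^{(j)}(a_{0}),\quad j=0,\dots,\ell,\qquad H^{(k)}(b_{0})=g^{(k)}(b_{0}),\quad k=0,\dots,r.$$ Then, for $a_0\le x\le b_0$, $$H(x)=\sum_{j=0}^{\ell}\frac{f^{(j)}(a_{0})}{j!}(x-a_{0})^{j}B_{r,\ell-j}(1-\xi(x))+\sum_{k=0}^{r}\frac{g^{(k)}(b_{0})}{k!}(x-b_{0})^{k}B_{\ell,r-k}(\xi(x)),$$ where $\xi(x)=(x-a_{0})/(b_{0}-a_{0})$. Furthermore, the regularized incomplete Beta-function can be written as $$B_{\ell,r}(x)=x^{\ell+1}\sum_{i=0}^{r}\binom{\ell+i}{i}(1-x)^{i},\qquad 0\le x\le 1.$$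
   Context: For non-negative integers $\ell,r$, the regularized incomplete Beta-function is $$B_{\ell,r}(x)=\frac{\int_{0}^{x}t^{\ell}(1-t)^{r}\,dt}{\int_{0}^{1}t^{\ell}(1-t)^{r}\,dt},\qquad 0\le x\le 1.$$ *)

(* Defs.v *)
From HB Require Import structures.
From mathcomp Require Export all_boot all_order all_algebra.
From mathcomp Require Export all_classical all_reals all_analysis.

Set Implicit Arguments.
Unset Strict Implicit.
Unset Printing Implicit Defensive.

Import Order.TTheory GRing.Theory Num.Theory.
Import numFieldNormedType.Exports.

Local Open Scope classical_set_scope.
Local Open Scope ring_scope.

(* [f] is of class C^n on a neighborhood of [a]. A function defined only near
   [a] is represented by an arbitrary total extension: the predicate and the
   derivatives [derive1n j f a], j <= n, depend only on the germ of [f] at [a].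
   Continuity of the derivatives of order k < n follows from differentiability. *)
Definition Cn_near (R : realType) (n : nat) (f : R -> R) (a : R) : Prop :=
  \forall x \near a,
    (forall k : nat, (k < n)%N -> derivable (derive1n k f) x 1) /\
    {for x, continuous (derive1n n f)}.

(* Meant for 0 <= x <= 1. *)
Definition reg_inc_beta (R : realType) (l r : nat) (x : R) : R :=
  (\int[lebesgue_measure]_(t in `[0, x]) (t ^+ l * (1 - t) ^+ r)) /
  (\int[lebesgue_measure]_(t in `[0, 1]) (t ^+ l * (1 - t) ^+ r)).

(* [size H <= l + r + 2] says that [H] has degree at most l + r + 1. *)
Definition two_point_interpolant (R : realType) (l r : nat) (a b : R)
    (f g : R -> R) (H : {poly R}) : Prop :=
  [/\ (size H <= l + r + 2)%N,
      forall j : nat, (j <= l)%N -> (H^`(j)).[a] = derive1n j f a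
    & forall k : nat, (k <= r)%N -> (H^`(k)).[b] = derive1n k g b].

(* Main.v *)
Require Import Defs.
From mathcomp Require Import ring.

Import Order.TTheory GRing.Theory Num.Theory.
Import numFieldNormedType.Exports.

Set Implicit Arguments.
Unset Strict Implicit.
Unset Printing Implicit Defensive.

Local Open Scope ring_scope.

(** Write [P l r] for the polynomial [X^(l+1) * sum_(i <= r) C(l+i, i) (1-X)^i],
    called [beta_poly R l r] below.  Everything rests on two of its properties.

    - Its derivative is a constant times [X^l (1-X)^r] ([deriv_beta_poly]): each
      new term of the sum has a derivative that merges with the one already
      obtained.  Since [P l r] is 0 at 0 and 1 at 1, the fundamental theorem of
      calculus shows that it is the regularized incomplete Beta function
      ([reg_inc_beta_poly]), the constant cancelling in the quotient.
    - It satisfies [P l r (X) + P r l (1-X) = 1] ([beta_poly_reflection]), because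
      the left-hand side has derivative zero.  Hence [P r m (1-X)] is a smooth
      step that is [1 + O(X^(m+1))] at 0 and [O((1-X)^(r+1))] at 1.

    With [m = l-j], multiplying [(x-a)^j] by such a step, rescaled to [[a, b]],
    leaves its derivatives at [a] unchanged up to order [l] and kills all
    derivatives at [b] up to order [r].  The first sum of the formula
    ([hermite_half]) therefore interpolates the data at [a] and is flat at [b];
    the second sum is the same construction with the end points exchanged.  As both
    have degree at most [l+r+1], their sum is an interpolant, and it is the only
    one: a difference of two is divisible by the coprime polynomials
    [(X-a)^(l+1)] and [(X-b)^(r+1)], so it vanishes for reasons of degree
    ([two_point_derivn_eq0]).

    Derivatives at [a] up to order [l] are handled as the coefficients of the
    polynomial translated by [a] ([horner_derivn_comp_shift]), so that the
    interpolation conditions become congruences modulo powers of [X]. *)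

(** * The closed form of the incomplete Beta function *)

Definition beta_poly (R : nzRingType) (l r : nat) : {poly R} :=
  'X^(l.+1) * \sum_(i < r.+1) 'C(l + i, i)%:R * (1 - 'X) ^+ i.
Arguments beta_poly : clear implicits.

Lemma horner_beta_poly (R : comNzRingType) (l r : nat) (x : R) :
  (beta_poly R l r).[x] =
  x ^+ l.+1 * \sum_(i < r.+1) 'C(l + i, i)%:R * (1 - x) ^+ i.
Proof.
rewrite /beta_poly hornerM hornerXn horner_sum; congr (_ * _).
apply: eq_bigr => i _.
rewrite hornerM -polyC_natr hornerC horner_exp.
by rewrite hornerD hornerN hornerC hornerX.
Qed.

Lemma beta_poly_at0 (R : comNzRingType) (l r : nat) : (beta_poly R l r).[0] = 0.
Proof. by rewrite horner_beta_poly exprS !mul0r. Qed.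

Lemma beta_poly_at1 (R : comNzRingType) (l r : nat) : (beta_poly R l r).[1] = 1.
Proof.
rewrite horner_beta_poly expr1n mul1r big_ord_recl bin0 mulr1 subrr big1 ?addr0//.
by move=> i _; rewrite /= exprS mul0r mulr0.
Qed.

Lemma size_beta_poly (R : comNzRingType) (l r : nat) :
  (size (beta_poly R l r) <= (l + r).+2)%N.
Proof.
apply: (leq_trans (size_polyMleq _ _)); rewrite size_polyXn addSn /=.
rewrite -addSn -addnS leq_add2l.
apply: (leq_trans (size_sum _ _ _)); apply/bigmax_leqP => i _.
rewrite -polyC_natr mul_polyC (leq_trans (size_scale_leq _ _))//.
rewrite (leq_trans (size_poly_exp_leq _ _))// ltnS.
have -> : (1 - 'X : {poly R}) = - ('X - 1%:P) by rewrite opprB polyC1.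
by rewrite size_polyN size_XsubC mul1n -ltnS.
Qed.

Lemma deriv_natr (R : nzRingType) (n : nat) : (n%:R : {poly R})^`() = 0.
Proof. by rewrite -polyC_natr derivC. Qed.

Lemma deriv_1subX (R : nzRingType) : (1 - 'X : {poly R})^`() = -1.
Proof. by rewrite derivB derivX -polyC1 derivC sub0r. Qed.

(** By induction on [r]: the derivative of the term of index [r+1] contains
    [-(r+1) C(l+r+1, r+1) X^(l+1) (1-X)^r], whose coefficient is, up to sign, the
    constant for [r]; with the induction hypothesis it makes a factor [1 - X]. *)
Lemma deriv_beta_poly (R : comNzRingType) (l r : nat) :
  (beta_poly R l r)^`() =
  ((l + r).+1 * 'C(l + r, r))%:R * ('X^l * (1 - 'X) ^+ r).
Proof.
elim: r => [|r IHr].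
  rewrite /beta_poly big_ord_recl big_ord0 addr0 addn0 bin0 muln1 expr0 !mulr1.
  by rewrite derivXn mulr_natl.
have -> : beta_poly R l r.+1 =
    beta_poly R l r + 'C(l + r.+1, r.+1)%:R * ('X^(l.+1) * (1 - 'X) ^+ r.+1).
  by rewrite /beta_poly big_ord_recr mulrDr /=; congr (_ + _); rewrite mulrCA.
have binE : ((l + r).+1 * 'C(l + r, r) = r.+1 * 'C(l + r.+1, r.+1))%N.
  by rewrite addnS mul_bin_diag.
rewrite derivD {}IHr binE !derivM derivXn deriv_exp deriv_1subX deriv_natr /=.
rewrite natrM -addSn natrM natrD !exprS; set c := 'C(_, _).
ring.
Qed.

Lemma deriv_eq0_const (R : numDomainType) (p : {poly R}) :
  p^`() = 0 -> p = (p.[0])%:P.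
Proof.
move=> dp0; apply/polyP => -[|i]; rewrite coefC ?horner_coef0//=.
apply/eqP; have := congr1 (fun q : {poly R} => q`_i) dp0.
by rewrite coef_deriv coef0 => /eqP; rewrite mulrn_eq0.
Qed.

(** The two derivatives are opposite, since [(l+r+1) C(l+r, r)] is symmetric in
    [l] and [r]; so the sum is constant, and its value at 0 is [0 + 1]. *)
Lemma beta_poly_reflection (R : numDomainType) (l r : nat) :
  beta_poly R l r + (beta_poly R r l \Po (1 - 'X)) = 1.
Proof.
set p := LHS; suff dp0 : p^`() = 0.
  rewrite (deriv_eq0_const dp0) /p hornerD horner_comp.
  have -> : (1 - 'X : {poly R}).[0] = 1 by rewrite !hornerE subr0.
  by rewrite beta_poly_at0 beta_poly_at1 add0r.
rewrite /p derivD deriv_comp !deriv_beta_poly deriv_1subX.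
rewrite comp_polyM rmorph_nat comp_polyM comp_Xn_poly rmorphXn /=.
rewrite comp_polyB comp_polyX rmorph1 subKr addnC -bin_sub ?leq_addr// addKn.
by rewrite (mulrC (_ ^+ r)) mulrN1 subrr.
Qed.

(** * Derivatives at a point and uniqueness of the interpolant *)

(** The Taylor coefficients at [a] are the coefficients after translation, because
    translation commutes with derivation. *)
Lemma horner_derivn_comp_shift (R : comNzRingType) (p : {poly R}) (a : R) i :
  (p^`(i)).[a] = (p \Po ('X + a%:P))`_i *+ i`!.
Proof.
have comp_shift : (p \Po ('X + a%:P))^`(i) = p^`(i) \Po ('X + a%:P).
  elim: i => // n IHn.
  by rewrite !derivnS IHn deriv_comp derivD derivX derivC addr0 mulr1.
have -> : (p^`(i)).[a] = (p^`(i) \Po ('X + a%:P)).[0].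
  by rewrite horner_comp !hornerE.
by rewrite -comp_shift horner_coef0 coef_derivn addn0 ffactnn.
Qed.

Lemma dvdp_exp_XsubC (R : numFieldType) (p : {poly R}) (a : R) n :
  (forall j, (j < n)%N -> (p^`(j)).[a] = 0) -> ('X - a%:P) ^+ n %| p.
Proof.
move=> dp0; pose q := p \Po ('X + a%:P).
have qE : q = drop_poly n q * 'X^n.
  rewrite -[LHS](poly_take_drop n) [take_poly n q](_ : _ = 0) ?add0r//.
  apply/polyP => i; rewrite coef_take_poly coef0; case: ifP => // lt_in.
  apply/eqP; have /eqP := dp0 _ lt_in.
  by rewrite horner_derivn_comp_shift mulrn_eq0 -[_ == 0%N]negbK -lt0n fact_gt0.
have -> : p = q \Po ('X - a%:P).
  by rewrite -comp_polyA comp_polyD comp_polyX comp_polyC subrK comp_polyXr.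
by rewrite qE comp_polyM comp_Xn_poly dvdp_mull.
Qed.

(** Uniqueness for two-point Hermite interpolation: a nonzero [p] would be a
    multiple of [(X-a)^(l+1) (X-b)^(r+1)], whose degree is [l+r+2]. *)
Lemma two_point_derivn_eq0 (R : numFieldType) (l r : nat) (a b : R)
    (p : {poly R}) :
  a != b -> (size p <= l + r + 2)%N ->
  (forall j, (j <= l)%N -> (p^`(j)).[a] = 0) ->
  (forall k, (k <= r)%N -> (p^`(k)).[b] = 0) -> p = 0.
Proof.
move=> ab sp pa pb; apply/eqP; apply: contraTT sp => p0; rewrite -ltnNge.
have cop : coprimep (('X - a%:P) ^+ l.+1) (('X - b%:P) ^+ r.+1).
  by apply/coprimep_expl/coprimep_expr/coprimep_XsubC2; rewrite subr_eq0 eq_sym.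
have dvd : ('X - a%:P) ^+ l.+1 * ('X - b%:P) ^+ r.+1 %| p.
  by rewrite Gauss_dvdp// !dvdp_exp_XsubC.
apply: (leq_trans _ (dvdp_leq p0 dvd)).
rewrite size_monicM ?monic_exp ?monicXsubC ?expf_neq0 ?polyXsubC_eq0//.
by rewrite !size_exp_XsubC !addSn !addnS addn0.
Qed.

(** * The half of the interpolant carried by one end point *)

(** With [xi = (x-a)/(b-a)], the argument [(x-b)/(a-b)] is [1 - xi].  Written this
    way, exchanging [a] and [b] turns one sum of the formula into the other. *)
Definition hermite_half (R : fieldType) (l r : nat) (a b : R) (d : nat -> R) :
    {poly R} :=
  \sum_(j < l.+1) (d j / (j`!)%:R) *:
    (('X - a%:P) ^+ j * (beta_poly R r (l - j) \Po ((a - b)^-1 *: ('X - b%:P)))).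

Lemma horner_hermite_half (R : fieldType) (l r : nat) (a b : R) (d : nat -> R) x :
  (hermite_half l r a b d).[x] = \sum_(j < l.+1) d j / (j`!)%:R *
    (x - a) ^+ j * (beta_poly R r (l - j)).[(x - b) / (a - b)].
Proof.
rewrite horner_sum; apply: eq_bigr => j _.
rewrite hornerZ hornerM horner_exp hornerXsubC horner_comp hornerZ hornerXsubC.
by rewrite mulrA [(a - b)^-1 * _]mulrC.
Qed.

Lemma size_hermite_half (R : fieldType) (l r : nat) (a b : R) (d : nat -> R) :
  (size (hermite_half l r a b d) <= l + r + 2)%N.
Proof.
apply: (leq_trans (size_sum _ _ _)); apply/bigmax_leqP => j _.
apply: (leq_trans (size_scale_leq _ _)).
apply: (leq_trans (size_polyMleq _ _)); rewrite size_exp_XsubC addSn /=.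
rewrite (@leq_trans (j + (r + (l - j)).+2))//.
  rewrite leq_add2l (leq_trans (size_comp_poly_leq _ _))// ltnS.
  rewrite (@leq_trans ((r + (l - j)).+1 * 1))//; last by rewrite muln1.
  apply: leq_mul; first by rewrite -subn1 leq_subLR add1n size_beta_poly.
  by rewrite -subn1 leq_subLR (leq_trans (size_scale_leq _ _)) ?size_XsubC.
by rewrite addn2 !addnS !ltnS addnCA subnKC 1?addnC// -ltnS.
Qed.

(** Every term is a multiple of [(X-b)^(r+1)], by the leading power in
    [beta_poly R r _]. *)
Lemma derivn_hermite_half_far (R : numFieldType) (l r : nat) (a b : R) d k :
  (k <= r)%N -> ((hermite_half l r a b d)^`(k)).[b] = 0.
Proof.
move=> kr; rewrite horner_derivn_comp_shift raddf_sum coef_sum.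
rewrite big1 ?mul0rn// => j _; rewrite /= comp_polyZ comp_polyM -comp_polyA coefZ.
rewrite comp_polyZ comp_polyB comp_polyX comp_polyC addrK.
rewrite /beta_poly comp_polyM comp_Xn_poly exprZn -!scalerAl -scalerAr.
by rewrite coefZ [_ * ('X^_ * _)]mulrCA coefXnM ltnS kr !mulr0 scaler0.
Qed.

(** After translation by [a], the argument of the step is [1 - X/(b-a)], so by
    reflection the step is [1 - P m r (X/(b-a))], which is 1 modulo [X^(m+1)]. *)
Lemma coef_comp_affine_beta_poly (R : numFieldType) (m r : nat) (a b : R) i :
  a != b -> (i <= m)%N ->
  (beta_poly R r m \Po ((a - b)^-1 *: ('X + (a - b)%:P)))`_i = (i == 0%N)%:R.
Proof.
move=> ab im; have ab0 : a - b != 0 by rewrite subr_eq0.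
have -> : (a - b)^-1 *: ('X + (a - b)%:P) = (1 - 'X) \Po ((b - a)^-1 *: 'X).
  rewrite comp_polyB comp_polyX rmorph1 -(opprB a b) invrN scaleNr opprK.
  by rewrite scalerDr scale_polyC mulVf// addrC.
rewrite comp_polyA.
have -> : beta_poly R r m \Po (1 - 'X) = 1 - beta_poly R m r.
  by apply: (canRL (addrK _)); rewrite addrC beta_poly_reflection.
rewrite comp_polyB rmorph1 /beta_poly comp_polyM comp_Xn_poly exprZn -scalerAl.
by rewrite coefB coefZ coefXnM ltnS im mulr0 subr0 coef1.
Qed.

(** After translation by [a], the term of index [j] is
    [d j / j! X^j (1 + O(X^(l-j+1)))]: it only contributes to the coefficient [j]
    among the first [l+1]. *)
Lemma derivn_hermite_half_near (R : numFieldType) (l r : nat) (a b : R) d k :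
  a != b -> (k <= l)%N -> ((hermite_half l r a b d)^`(k)).[a] = d k.
Proof.
move=> ab kl; rewrite horner_derivn_comp_shift raddf_sum coef_sum /=.
have term (j : 'I_l.+1) : ((d j / (j`!)%:R) *: (('X - a%:P) ^+ j *
      (beta_poly R r (l - j) \Po ((a - b)^-1 *: ('X - b%:P)))) \Po
      ('X + a%:P))`_k = (d j / (j`!)%:R) * (k == j)%:R.
  rewrite comp_polyZ comp_polyM -comp_polyA coefZ rmorphXn /=.
  rewrite comp_polyZ !comp_polyB comp_polyX !comp_polyC addrK -addrA -polyCB.
  rewrite coefXnM; case: ltnP => [kj|jk]; first by rewrite ltn_eqF.
  rewrite coef_comp_affine_beta_poly ?leq_sub2r//.
  by rewrite subn_eq0 eqn_leq jk andbT.
rewrite (eq_bigr _ (fun j _ => term j)).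
rewrite (bigD1 (Ordinal (kl : (k < l.+1)%N)))//= big1 => [|j jk].
  by rewrite eqxx mulr1 addr0 -[LHS]mulr_natr divfK ?pnatr_eq0 -?lt0n ?fact_gt0.
suff /negbTE -> : k != j by rewrite mulr0.
by apply: contraNneq jk => kj; apply/eqP/val_inj.
Qed.

(** * Integration *)

Lemma Rintegral_deriv_poly (R : realType) (p : {poly R}) (a b : R) : a <= b ->
  (\int[lebesgue_measure]_(t in `[a, b]%classic) p^`().[t])%R = p.[b] - p.[a].
Proof.
rewrite le_eqVlt => /predU1P[->|ab].
  by rewrite set_itv1 Rintegral_set1 subrr.
rewrite /Rintegral (@continuous_FTC2 _ _ (horner p))//.
- by apply: continuous_in_subspaceT => x _; exact: continuous_horner.
- split.
  + by move=> x _; have [] := is_derive_poly p x.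
  + by apply: cvg_at_right_filter; exact: continuous_horner.
  + by apply: cvg_at_left_filter; exact: continuous_horner.
- by move=> x _; rewrite derive1E; have [_ ->] := is_derive_poly p x.
Qed.

Lemma reg_inc_beta_poly (R : realType) (l r : nat) (x : R) :
  0 <= x -> reg_inc_beta l r x = (beta_poly R l r).[x].
Proof.
move=> x0; pose c : R := ((l + r).+1 * 'C(l + r, r))%:R.
have c0 : c != 0 by rewrite pnatr_eq0 muln_eq0 /= -lt0n bin_gt0 leq_addl.
(* The antiderivative of the integrand that vanishes at 0. *)
pose q := c^-1 *: beta_poly R l r.
have qE (t : R) : t ^+ l * (1 - t) ^+ r = q^`().[t].
  rewrite derivZ deriv_beta_poly -polyC_natr mul_polyC scalerA mulVf// scale1r.
  by rewrite !hornerE.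
rewrite /reg_inc_beta.
under eq_Rintegral do rewrite qE.
under [X in _ / X]eq_Rintegral do rewrite qE.
rewrite !Rintegral_deriv_poly// !hornerZ beta_poly_at0 beta_poly_at1.
by rewrite !mulr0 !subr0 mulr1 invrK mulrAC mulVf// mul1r.
Qed.

(** * The interpolation formula *)

Theorem theorem2 (R : realType) (l r : nat) :
  (forall (a0 b0 : R) (f g : R -> R),
     a0 < b0 -> Cn_near l f a0 -> Cn_near r g b0 ->
     (exists! H : {poly R}, two_point_interpolant l r a0 b0 f g H) /\
     forall H : {poly R}, two_point_interpolant l r a0 b0 f g H ->
     let xi := fun x : R => (x - a0) / (b0 - a0) in
     forall x : R, a0 <= x <= b0 ->
       H.[x] =
         \sum_(j < l.+1) derive1n j f a0 / (j`!)%:R * (x - a0) ^+ j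
                         * reg_inc_beta r (l - j)%N (1 - xi x)
       + \sum_(k < r.+1) derive1n k g b0 / (k`!)%:R * (x - b0) ^+ k
                         * reg_inc_beta l (r - k)%N (xi x)) /\
  (forall x : R, 0 <= x <= 1 ->
     reg_inc_beta l r x =
       x ^+ l.+1 * \sum_(i < r.+1) 'C(l + i, i)%:R * (1 - x) ^+ i).
Proof.
split=> [a b f g ltab _ _|x /andP[x0 _]]; last first.
  by rewrite reg_inc_beta_poly// horner_beta_poly.
have ab : a != b by rewrite lt_eqF.
have ba : b != a by rewrite eq_sym.
pose H0 := hermite_half l r a b (fun j => derive1n j f a) +
           hermite_half r l b a (fun k => derive1n k g b).
have H0P : two_point_interpolant l r a b f g H0.
  split=> [|j jl|k kr].
  - rewrite (leq_trans (size_polyD _ _))// geq_max size_hermite_half.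
    by rewrite (addnC l) size_hermite_half.
  - rewrite derivnD hornerD derivn_hermite_half_near//.
    by rewrite derivn_hermite_half_far// addr0.
  - rewrite derivnD hornerD derivn_hermite_half_near//.
    by rewrite derivn_hermite_half_far// add0r.
have uniqH H : two_point_interpolant l r a b f g H -> H0 = H.
  case: H0P => sH0 H0a H0b [sH Ha Hb]; apply/eqP; rewrite -subr_eq0; apply/eqP.
  apply: (@two_point_derivn_eq0 _ l r _ _ _ ab) => [|j jl|k kr].
  - by rewrite (leq_trans (size_polyD _ _))// size_polyN geq_max sH0 sH.
  - by rewrite derivnB hornerD hornerN H0a// Ha// subrr.
  - by rewrite derivnB hornerD hornerN H0b// Hb// subrr.
split; first by exists H0; split=> //; exact: uniqH.
move=> H /uniqH <- xi x /andP[ax xb].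
have ab0 : 0 < b - a by rewrite subr_gt0.
have xi0 : 0 <= xi x by rewrite divr_ge0 ?subr_ge0// ltW.
have xi1E : 1 - xi x = (x - b) / (a - b).
  by rewrite /xi; field; rewrite !subr_eq0 ab ba.
have xi1 : 0 <= 1 - xi x.
  by rewrite subr_ge0 ler_pdivrMr// mul1r lerD2r.
rewrite hornerD !horner_hermite_half; congr (_ + _); apply: eq_bigr => i _.
- by rewrite reg_inc_beta_poly// xi1E.
- by rewrite reg_inc_beta_poly.
Qed.
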